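(* There is no tuple $((Z_i)_{i\in2},S_0,S_1)$, where $Z_0,Z_1$ are Polish spaces and $S_0,S_1$ are disjoint analytic subsets of $Z_0\times Z_1$, such that for every tuple $((X_i)_{i\in2},B_0,B_1)$ with $X_0,X_1$ Polish and $B_0,B_1$ disjoint analytic subsets of $X_0\times X_1$ exactly one of the following holds: (a) $B_0$ is separable from $B_1$ by a $\mathrm{pot}(\Pi^0_1)$ set; (b) $((Z_i)_{i\in2},S_0,S_1)\sqsubseteq((X_i)_{i\in2},B_0,B_1)$.
   Context: A Borel $B\subseteq X_0\times X_1$ is $\mathrm{pot}(\Pi^0_1)$ if there are finer 0-dimensional Polish topologies $\tau_i$ on $X_i$ with $B$ closed in $(X_0,\tau_0)\times(X_1,\tau_1)$; ''$B_0$ is separable from $B_1$ by a $\mathrm{pot}(\Pi^0_1)$ set'' means some such set contains $B_0$ and is disjoint from $B_1$. $((Z_i)_{i\in2},S_0,S_1)\sqsubseteq((X_i)_{i\in2},B_0,B_1)$ means there are continuous $f_i:Z_i\to X_i$ ($i\in\{0,1\}$) such that $(f_0\times f_1)$ restricted to $S_0\cup S_1$ is one-to-one and $S_\varepsilon\subseteq(f_0\times f_1)^{-1}(B_\varepsilon)$ for each $\varepsilon\in\{0,1\}$. *)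

(* Defs.v *)
From HB Require Import structures.
From mathcomp Require Import all_boot all_algebra.
From mathcomp Require Import all_classical all_reals topology metric_structure measure.

Set Implicit Arguments.
Unset Strict Implicit.
Unset Printing Implicit Defensive.

Local Open Scope classical_set_scope.

(* Topologies (resp. metrics) on a fixed set [T] are elements [t] of the class
   [Topological T] (resp. [Metric R T]); [Topological.Pack t] then has [T] itself
   as its carrier. *)

Definition prod_space (X0 X1 : topologicalType) : topologicalType :=
  (X0 * X1)%type.

Definition complete_metric (R : realType) (M : metricType R) :=
  forall F : set_system M, ProperFilter F -> cauchy F -> exists x : M, F --> x.

Definition completely_metrizable (R : realType) (T : topologicalType) :=
  exists m : Metric R T, let M : metricType R := Metric.Pack m in
    (forall U : set T, @open M U <-> @open T U) /\ complete_metric M.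

Definition separable (T : topologicalType) :=
  exists2 D : set T, countable D & dense D.

Definition polish (R : realType) (T : topologicalType) :=
  separable T /\ completely_metrizable R T.

(* The library's [zero_dimensional] only separates points by clopen sets, which
   is strictly weaker, even for Polish spaces. *)
Definition clopen_basis (T : topologicalType) := basis (@clopen T).

Definition borel (T : topologicalType) (B : set T) := <<s @open T >> B.

(* As the domain may be empty, the empty set is analytic. *)
Definition analytic (R : realType) (T : topologicalType) (A : set T) :=
  exists (Y : topologicalType) (f : Y -> T),
    [/\ polish R Y, continuous f & range f = A].

Definition finer_zero_dim_polish (R : realType) (X : topologicalType)
    (t : Topological X) :=
  let Y : topologicalType := Topological.Pack t in
  [/\ forall U : set X, @open X U -> @open Y U, polish R Y & clopen_basis Y].

Definition pot_closed (R : realType) (X0 X1 : topologicalType)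
    (B : set (prod_space X0 X1)) :=
  borel B /\
  exists (t0 : Topological X0) (t1 : Topological X1),
    [/\ finer_zero_dim_polish R t0, finer_zero_dim_polish R t1 &
        @closed (prod_space (Topological.Pack t0) (Topological.Pack t1)) B].

Definition pot_closed_separable (R : realType) (X0 X1 : topologicalType)
    (B0 B1 : set (prod_space X0 X1)) :=
  exists B : set (prod_space X0 X1),
    [/\ pot_closed R B, B0 `<=` B & B `&` B1 = set0].

Definition prod_map (Z0 Z1 X0 X1 : Type) (f0 : Z0 -> X0) (f1 : Z1 -> X1)
    (z : Z0 * Z1) : X0 * X1 := (f0 z.1, f1 z.2).

Definition inj_reducible (Z0 Z1 : topologicalType)
    (S0 S1 : set (prod_space Z0 Z1)) (X0 X1 : topologicalType)
    (B0 B1 : set (prod_space X0 X1)) :=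
  exists (f0 : Z0 -> X0) (f1 : Z1 -> X1),
    [/\ continuous f0, continuous f1,
        set_inj (S0 `|` S1) (prod_map f0 f1),
        S0 `<=` prod_map f0 f1 @^-1` B0 &
        S1 `<=` prod_map f0 f1 @^-1` B1].

Definition disjoint_analytic_pair (R : realType) (X0 X1 : topologicalType)
    (B0 B1 : set (prod_space X0 X1)) :=
  [/\ polish R X0, polish R X1, analytic R B0, analytic R B1 &
      B0 `&` B1 = set0].

Definition exactly_one (P Q : Prop) := (P /\ ~ Q) \/ (~ P /\ Q).

(* Main.v *)
(* Two graphs on the Baire space, both generated by countably many functions close
   to the identity, are not separable from the diagonal by a potentially closed set:
   the graph of the involutions [flips l], which change all entries from [l] on, and
   the graph of the maps [fold l], which decode the rows of index [>= l] of [x] from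
   its row of index [l]. Indeed all these maps preserve comeager sets, and a finer
   Polish topology only adds Borel sets, which have the Baire property. A minimum
   [(S0, S1)] would thus reduce to both; as [S1] is mapped injectively into the
   diagonal, the image of [(S0, S1)] in the product is a graph on a set on which both
   coordinates are injective. Since [flips l] is injective, the rows of index [<= l]
   of the second coordinate then determine the source of an edge coming from
   [flips n] and [fold l]; as edges of [fold l'] with [l' > l] keep these rows, the
   set of such sources splits into countably many independent analytic sets, and the
   image is separable after all, a contradiction. *)
From HB Require Import structures.
Require Import Defs.
From mathcomp Require Import all_boot all_order all_algebra.
From mathcomp Require Import all_classical all_reals topology metric_structure measure.
From mathcomp Require Import zify lra.

Set Implicit Arguments.
Unset Strict Implicit.
Unset Printing Implicit Defensive.

Import Order.TTheory GRing.Theory Num.Theory.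

Local Open Scope classical_set_scope.

Local Notation baire := (nat -> nat).

Definition agree n (x y : baire) := forall i, i < n -> x i = y i.

Lemma agree_sym n x y : agree n x y -> agree n y x.
Proof. by move=> xy i /xy. Qed.

Lemma agree_trans n y x z : agree n x y -> agree n y z -> agree n x z.
Proof. by move=> xy yz i ni; rewrite xy// yz. Qed.

Lemma agree_le m n x y : m <= n -> agree n x y -> agree m x y.
Proof. by move=> mn xy i im; apply: xy; apply: leq_trans mn. Qed.

Lemma agreeP x y : (forall n, agree n x y) -> x = y.
Proof. by move=> xy; apply/funext => i; apply: (xy i.+1). Qed.

Lemma agree_limit (s : nat -> baire) : (forall n, agree n (s n) (s n.+1)) ->
  forall n, agree n (s n) (fun i => s i.+1 i).
Proof.
move=> ss; have smn m n : m <= n -> agree m (s m) (s n).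
  elim: n => [|n IH]; first by rewrite leqn0 => /eqP ->.
  rewrite leq_eqVlt => /predU1P[->//|]; rewrite ltnS => mn.
  by apply: agree_trans (IH mn) _; apply: agree_le (ss n).
by move=> n i ni; rewrite -(smn i.+1 n).
Qed.

Definition bound (f : nat -> nat) n := \max_(i < n) (f i).+1.

Lemma boundP (f : nat -> nat) n i : i < n -> f i < bound f n.
Proof. by move=> ni; apply: (@leq_bigmax _ (fun i : 'I_n => (f i).+1) (Ordinal ni)). Qed.

Definition baire_closed (F : set baire) :=
  forall x, (forall n, exists2 y, agree n x y & F y) -> F x.

Definition baire_open (U : set baire) :=
  forall x, U x -> exists n, forall y, agree n x y -> U y.

Definition baire_dense (U : set baire) := forall x n, exists2 y, agree n x y & U y.

Definition baire_cont (f : baire -> baire) :=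
  forall x n, exists m, forall y, agree m x y -> agree n (f x) (f y).

Lemma baire_cont_comp f g : baire_cont f -> baire_cont g -> baire_cont (f \o g).
Proof.
move=> cf cg x n; have [m fm] := cf (g x) n; have [k gk] := cg x m.
by exists k => y /gk/fm.
Qed.

Lemma baire_cont_reindex (h : nat -> nat) : baire_cont (fun x => x \o h).
Proof. by move=> x n; exists (bound h n) => y xy i ni /=; rewrite xy ?boundP. Qed.

Lemma baire_cont_coord (f : baire -> baire) :
  (forall x i, exists m, forall y, agree m x y -> f x i = f y i) -> baire_cont f.
Proof.
move=> H x n; have [m xm] := choice (H x); exists (bound m n) => y xy i ni.
by apply: xm; apply: agree_le xy; rewrite ltnW// boundP.
Qed.

Lemma baire_closedI F G : baire_closed F -> baire_closed G -> baire_closed (F `&` G).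
Proof.
by move=> cF cG x xl; split; [apply: cF|apply: cG] => n;
  have [y xy []] := xl n; exists y.
Qed.

Lemma baire_closed_eq f g : baire_cont f -> baire_cont g ->
  baire_closed [set x | f x = g x].
Proof.
move=> cf cg x xl; apply: agreeP => n; have [m fm] := cf x n.
have [k gk] := cg x n; have [y xy /= fgy] := xl (maxn m k).
have {}fm := fm y (agree_le (leq_maxl _ _) xy).
have {}gk := gk y (agree_le (leq_maxr _ _) xy).
by apply: agree_trans fm _; rewrite fgy; apply: agree_sym.
Qed.

Lemma baire_closed_coord f i (a : nat) : baire_cont f -> baire_closed [set x | f x i = a].
Proof.
move=> cf x xl; have [m fm] := cf x i.+1; have [y xy /= <-] := xl m.
exact: fm.
Qed.

Lemma baire_closed_forall (I : Type) (F : I -> set baire) :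
  (forall i, baire_closed (F i)) -> baire_closed [set x | forall i, F i x].
Proof.
by move=> cF x xl i; apply: cF => n; have [y xy Fy] := xl n; exists y => //.
Qed.

Inductive baire_borel : set baire -> Prop :=
| baire_borel_coord i a : baire_borel [set x | x i = a]
| baire_borelC A : baire_borel A -> baire_borel (~` A)
| baire_borel_bigcup (A : nat -> set baire) :
    (forall i, baire_borel (A i)) -> baire_borel (\bigcup_i A i).

Lemma baire_borel_bigcap (A : nat -> set baire) :
  (forall i, baire_borel (A i)) -> baire_borel (\bigcap_i A i).
Proof.
move=> bA; rewrite -[X in baire_borel X]setCK setC_bigcap; apply: baire_borelC.
by apply: baire_borel_bigcup => i; apply: baire_borelC.
Qed.

Lemma baire_borelT : baire_borel setT.
Proof.
rewrite (_ : setT = \bigcup_a [set x : baire | x 0 = a]).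
  by apply: baire_borel_bigcup => a; apply: baire_borel_coord.
by apply/seteqP; split => // x _; exists (x 0).
Qed.

Lemma baire_borel0 : baire_borel set0.
Proof. by rewrite -setCT; apply/baire_borelC/baire_borelT. Qed.

Section rectangle_separation.
Variables (f f' g0 g1 : baire -> baire) (F F' G : set baire).
Hypotheses (cf : baire_cont f) (cf' : baire_cont f').
Hypotheses (cg0 : baire_cont g0) (cg1 : baire_cont g1).
Hypotheses (cF : baire_closed F) (cF' : baire_closed F') (cG : baire_closed G).

Let separated n (s : baire * baire * baire) := exists P Q,
  [/\ baire_borel P, baire_borel Q,
      forall w, agree n s.1.1 w -> F w -> P (f w),
      forall w, agree n s.1.2 w -> F' w -> Q (f' w) &
      forall v, agree n s.2 v -> G v -> P (g0 v) -> Q (g1 v) -> False].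

Let upd (x : baire) n i : baire := fun k => if k == n then i else x k.

Let agree_upd n x w : agree n x w -> agree n.+1 (upd x n (w n)) w.
Proof.
move=> xw i; rewrite /upd ltnS leq_eqVlt => /predU1P[->|ni]; first by rewrite eqxx.
by rewrite (ltn_eqF ni) xw.
Qed.

Let separated_step n s :
  (forall i j k, separated n.+1 (upd s.1.1 n i, upd s.1.2 n j, upd s.2 n k)) ->
  separated n s.
Proof.
move=> H.
have {}H (t : nat * nat * nat) : exists PQ : set baire * set baire,
    [/\ baire_borel PQ.1, baire_borel PQ.2,
      forall w, agree n.+1 (upd s.1.1 n t.1.1) w -> F w -> PQ.1 (f w),
      forall w, agree n.+1 (upd s.1.2 n t.1.2) w -> F' w -> PQ.2 (f' w) &
      forall v, agree n.+1 (upd s.2 n t.2) v -> G v ->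
        PQ.1 (g0 v) -> PQ.2 (g1 v) -> False].
  by have [P [Q ?]] := H t.1.1 t.1.2 t.2; exists (P, Q).
have [PQ HPQ] := choice H.
exists (\bigcup_i \bigcap_j \bigcap_k (PQ (i, j, k)).1).
exists (\bigcup_j \bigcap_i \bigcap_k (PQ (i, j, k)).2); split.
- apply: baire_borel_bigcup => i; apply: baire_borel_bigcap => j.
  by apply: baire_borel_bigcap => k; case: (HPQ (i, j, k)).
- apply: baire_borel_bigcup => j; apply: baire_borel_bigcap => i.
  by apply: baire_borel_bigcap => k; case: (HPQ (i, j, k)).
- move=> w sw Fw; exists (w n) => // j _ k _.
  by case: (HPQ (w n, j, k)) => _ _ + _ _; apply => //; apply: agree_upd.
- move=> w sw Fw; exists (w n) => // i _ k _.
  by case: (HPQ (i, w n, k)) => _ _ _ + _; apply => //; apply: agree_upd.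
- move=> v sv Gv [i _ Pi] [j _ Qj].
  case: (HPQ (i, j, v n)) => _ _ _ _ /(_ v); apply => //.
  + exact: agree_upd.
  + exact: Pi.
  + exact: Qj.
Qed.

(* The usual proof of Lusin's separation theorem, for rectangles: a pair that
   cannot be separated yields a branch along which no cylinders can be separated,
   against the continuity of the maps at its limit. *)
Lemma rectangle_separation :
  (forall w w' v, F w -> F' w' -> G v -> g0 v = f w -> g1 v = f' w' -> False) ->
  exists P Q, [/\ baire_borel P, baire_borel Q,
    forall w, F w -> P (f w), forall w, F' w -> Q (f' w) &
    forall v, G v -> P (g0 v) -> Q (g1 v) -> False].
Proof.
move=> FG; have [[P [Q [bP bQ FP FQ H]]]|nsep] :=
  pselect (separated 0 (fun=> 0, fun=> 0, fun=> 0)).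
  exists P, Q; split => //; first by move=> w; apply: FP.
    by move=> w; apply: FQ.
  by move=> w; apply: H.
exfalso.
have step (t : nat * (baire * baire * baire)) : exists s : baire * baire * baire,
    ~ separated t.1 t.2 -> ~ separated t.1.+1 s /\
    [/\ agree t.1 t.2.1.1 s.1.1, agree t.1 t.2.1.2 s.1.2 & agree t.1 t.2.2 s.2].
  have [ns|] := pselect (separated t.1 t.2); first by exists t.2.
  move=> ns; apply: contrapT => H; apply: ns; apply: separated_step => i j k.
  apply: contrapT => K; apply: H; eexists; split; first exact: K.
  by split => l lt /=; rewrite /upd (ltn_eqF lt).
have [nxt nxtP] := choice step.
pose fix s n := if n is n'.+1 then nxt (n', s n') else (fun=> 0, fun=> 0, fun=> 0).
have ns n : ~ separated n (s n).
  by elim: n => [//|n IH]; case: (nxtP (n, s n) IH).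
have ss n := (nxtP (n, s n) (ns n)).2.
have ax := @agree_limit (fun n => (s n).1.1) (fun n => let: And3 a _ _ := ss n in a).
have ay := @agree_limit (fun n => (s n).1.2) (fun n => let: And3 _ a _ := ss n in a).
have az := @agree_limit (fun n => (s n).2) (fun n => let: And3 _ _ a := ss n in a).
move: ax ay az; set x := (X in forall n, agree n _ X); move=> ax.
set y := (X in forall n, agree n _ X); move=> ay.
set z := (X in forall n, agree n _ X); move=> az.
have Fx : F x.
  apply: cF => n; apply: contrapT => H; apply: (ns n); exists set0, setT; split => //.
  - exact: baire_borel0.
  - exact: baire_borelT.
  - move=> w sw Fw; apply: H; exists w => //.
    by apply: agree_trans sw; apply: agree_sym.
have Fy : F' y.
  apply: cF' => n; apply: contrapT => H; apply: (ns n); exists setT, set0; split => //.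
  - exact: baire_borelT.
  - exact: baire_borel0.
  - move=> w sw Fw; apply: H; exists w => //.
    by apply: agree_trans sw; apply: agree_sym.
have Gz : G z.
  apply: cG => n; apply: contrapT => H; apply: (ns n); exists setT, setT; split => //.
  - exact: baire_borelT.
  - exact: baire_borelT.
  - move=> w sw Fw; exfalso; apply: H; exists w => //.
    by apply: agree_trans sw; apply: agree_sym.
have limP n t l w : agree n t l -> agree n t w -> agree n l w.
  by move=> tl tw; apply: agree_trans tw; apply: agree_sym.
have e0 : g0 z = f x.
  apply/funext => i; apply: contrapT => ne.
  have [m fm] := cf x i.+1; have [k gk] := cg0 z i.+1.
  pose n := maxn m k.
  apply: (ns n); exists [set p | p i = f x i], setT; split => //.
  - exact: baire_borel_coord.
  - exact: baire_borelT.
  - move=> w sw _ /=; apply/esym/fm => //; apply: agree_le (leq_maxl m k) _.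
    exact: limP (ax _) sw.
  - move=> v sv _ /= e _; apply: ne; rewrite -e; apply: gk => //.
    by apply: agree_le (leq_maxr m k) _; apply: limP (az _) sv.
have e1 : g1 z = f' y.
  apply/funext => i; apply: contrapT => ne.
  have [m fm] := cf' y i.+1; have [k gk] := cg1 z i.+1.
  pose n := maxn m k.
  apply: (ns n); exists setT, [set p | p i = f' y i]; split => //.
  - exact: baire_borelT.
  - exact: baire_borel_coord.
  - move=> w sw _ /=; apply/esym/fm => //; apply: agree_le (leq_maxl m k) _.
    exact: limP (ay _) sw.
  - move=> v sv _ _ /= e; apply: ne; rewrite -e; apply: gk => //.
    by apply: agree_le (leq_maxr m k) _; apply: limP (az _) sv.
exact: FG Fx Fy Gz e0 e1.
Qed.

End rectangle_separation.

Definition closed_graph (u : baire -> baire) := forall z w,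
  (forall n, exists2 z', agree n z z' & agree n w (u z')) -> w = u z.

Definition encoded (A : set baire) (u : baire -> baire) :=
  closed_graph u /\ forall z, A z <-> u z 0 <> 0.

Definition interleave (u : nat -> baire -> baire) (z : baire) : baire :=
  fun c => if @pickle_inv (nat * nat)%type c is Some (i, j) then u i z j else 0.

Lemma interleaveE u z i j : interleave u z (pickle (i, j)) = u i z j.
Proof. by rewrite /interleave pickleK_inv. Qed.

Lemma closed_graph_interleave u :
  (forall i, closed_graph (u i)) -> closed_graph (interleave u).
Proof.
move=> cu z w zw.
have wu i j : w (pickle (i, j)) = u i z j.
  suff -> : u i z = fun j => w (pickle (i, j)) by [].
  apply/esym/cu => n; pose m := maxn n (bound (fun j => pickle (i, j)) n).
  have [z' zz' wz'] := zw m; exists z'; first exact: agree_le (leq_maxl _ _) zz'.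
  move=> k kn; rewrite wz' ?interleaveE//.
  exact: leq_trans (boundP (fun j => pickle (i, j)) kn) (leq_maxr _ _).
apply/funext => c; rewrite /interleave.
have [z' _ wz'] := zw c.+1; have := wz' c (ltnSn c); rewrite /interleave.
case E : (pickle_inv c) => [[i j]|//] _; rewrite -wu; congr w.
by have := @pickle_invK (nat * nat)%type c; rewrite E /=.
Qed.

Definition consN (a : nat) (x : baire) : baire := fun k => if k is k'.+1 then x k' else a.

Definition shift (x : baire) : baire := fun k => x k.+1.

Lemma consNE x : x = consN (x 0) (shift x).
Proof. by apply/funext; case. Qed.

Lemma closed_graph_cons (m : baire -> nat) u : closed_graph u ->
  (forall z a, (forall n, exists z', [/\ agree n z z', agree n (u z) (u z') & m z' = a]) ->
     m z = a) ->
  closed_graph (fun z => consN (m z) (u z)).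
Proof.
move=> cu mP z w zw.
have wu : shift w = u z.
  apply: cu => n; have [z' zz' wz'] := zw n.+1.
  by exists z'; [apply: agree_le zz'|move=> i ni; apply: (wz' i.+1)].
rewrite [LHS]consNE wu; congr consN; apply/esym/mP => n.
have [z' zz' wz'] := zw n.+1; exists z'; split; first exact: agree_le zz'.
- by move=> i ni; rewrite -wu; apply: (wz' i.+1).
- by rewrite (wz' 0).
Qed.

Lemma encoded_coord i a : exists u, encoded [set x | x i = a] u.
Proof.
exists (fun z => fun=> nat_of_bool (z i == a)); split.
- move=> z w zw; apply/funext => k; have [z' zz' ->] := zw (maxn i k).+1.
    by rewrite zz'// ltnS leq_maxl.
  by rewrite ltnS leq_maxr.
- by move=> z /=; case: eqP.
Qed.

Lemma encodedC A u : encoded A u -> exists v, encoded (~` A) v.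
Proof.
move=> [cu Au]; exists (fun z => consN (u z 0 == 0) (u z)); split.
  by apply: closed_graph_cons => // z a /(_ 1) [z' [_ uu <-]]; rewrite (uu 0).
move=> z /=; split; first by move=> nA; have [//|/eqP/Au//] := eqVneq (u z 0) 0.
by case: eqP => // u0 _ /Au.
Qed.

Lemma encoded_bigcup (A : nat -> set baire) :
  (forall i, exists u, encoded (A i) u) -> exists u, encoded (\bigcup_i A i) u.
Proof.
move=> /choice[u uA].
pose m z := if pselect (exists n, u n z 0 != 0) is left e then (ex_minn e).+1 else 0.
exists (fun z => consN (m z) (interleave u z)); split.
  apply: closed_graph_cons; first by apply: closed_graph_interleave => i; case: (uA i).
  move=> z a zl.
  have key n : exists z', m z' = a /\
      forall j, j < maxn n a -> u j z' 0 = u j z 0.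
    have [z' [_ uu mz']] := zl (bound (fun j => @pickle (nat * nat)%type (j, 0)) (maxn n a)).
    exists z'; split => // j jn; rewrite -(interleaveE u z') -(interleaveE u z).
    by apply/esym/uu; apply: (boundP (fun j => @pickle (nat * nat)%type (j, 0))).
  case: a {zl} key => [|a] key.
    rewrite /m; case: pselect => // -[n un]; exfalso.
    have [z' [+ uz']] := key n.+1; rewrite /m; case: pselect => // H _; apply: H.
    by exists n; rewrite uz'// leq_max ltnSn.
  have [z' [+ uz']] := key 0; rewrite /m; case: pselect => //= e.
  case: ex_minnP => k uk kmin [ka]; move: uk kmin; rewrite ka => ua amin.
  have ua' : u a z 0 != 0 by rewrite -uz'// leq_max ltnSn orbT.
  case: pselect => [e'|]; last by case; exists a.
  case: ex_minnP => l ul lmin; congr _.+1; apply/eqP; rewrite eqn_leq lmin//=.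
  apply: amin; rewrite uz'//; rewrite leq_max ltnS lmin// orbT//.
move=> z /=; rewrite /m; split.
  move=> [i _ /(proj2 (uA i) z)/eqP ui]; case: pselect => //; case; by exists i.
case: pselect => // -[n un] _; exists n => //; apply/(proj2 (uA n) z); exact/eqP.
Qed.

Lemma borel_encoded A : baire_borel A -> exists u, encoded A u.
Proof.
elim => [i a|B _ [u Bu]|B _ IH]; first exact: encoded_coord.
- exact: encodedC Bu.
- exact: encoded_bigcup.
Qed.

Definition comeager (G : set baire) := exists O : nat -> set baire,
  (forall i, baire_open (O i) /\ baire_dense (O i)) /\
  forall x, (forall i, O i x) -> G x.

Lemma comeager_sub G H : G `<=` H -> comeager G -> comeager H.
Proof. by move=> GH [O [Od OG]]; exists O; split => // x /OG/GH. Qed.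

Lemma comeager_bigcap (G : nat -> set baire) :
  (forall i, comeager (G i)) -> comeager [set x | forall i, G i x].
Proof.
move=> /choice[O OG].
exists (fun c => if @unpickle (nat * nat)%type c is Some (i, j) then O i j else setT).
split.
  move=> c; case: unpickle => [[i j]|]; first exact: (OG i).1.
  by split => [x _|x n]; [exists 0|exists x].
by move=> x xO i; apply: (OG i).2 => j; have := xO (pickle (i, j)); rewrite pickleK.
Qed.

Lemma comeagerI G H : comeager G -> comeager H -> comeager (G `&` H).
Proof.
move=> cG cH; apply: comeager_sub (comeager_bigcap (G := fun i => if i is 0 then G else H) _).
  by move=> x GH; split; [exact: (GH 0)|exact: (GH 1)].
by case.
Qed.

Lemma comeager_dense G : comeager G -> baire_dense G.
Proof.
move=> [O [Od OG]] x0 n0.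
have step (t : nat * (baire * nat)) : exists s : baire * nat,
    [/\ agree t.2.2 t.2.1 s.1, t.2.2 < s.2 & forall y, agree s.2 s.1 y -> O t.1 y].
  have [y xy Oy] := (Od t.1).2 t.2.1 t.2.2; have [k yk] := (Od t.1).1 y Oy.
  exists (y, maxn k t.2.2.+1); split => //=; first by rewrite leq_max ltnSn orbT.
  by move=> w yw; apply: yk; apply: agree_le yw; apply: leq_maxl.
have [nxt nxtP] := choice step.
pose fix s i := if i is i'.+1 then nxt (i', s i') else (x0, n0).
have sP i := nxtP (i, s i).
have sn i : n0 + i <= (s i).2.
  by elim: i => [|i IH]; [rewrite addn0|rewrite addnS; case: (sP i) => _ + _; apply: leq_ltn_trans].
have ss i j : i <= j -> agree (s i).2 (s i).1 (s j).1 /\ (s i).2 <= (s j).2.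
  elim: j => [|j IH]; first by rewrite leqn0 => /eqP ->.
  rewrite leq_eqVlt => /predU1P[->//|]; rewrite ltnS => ij.
  have [a b] := IH ij; have [c d _] := sP j; split.
    by apply: agree_trans a _; apply: agree_le b c.
  exact: leq_trans b (ltnW d).
pose x : baire := fun i => (s i.+1).1 i.
have sx i : agree (s i).2 (s i).1 x.
  move=> k ki; rewrite /x; have [ik|ki'] := leqP i k.+1; first by have [-> //] := ss _ _ ik.
  have [a b] := ss _ _ (ltnW ki'); apply/esym/a.
  by have := sn k.+1; lia.
exists x; first exact: (sx 0).
by apply: OG => i; case: (sP i) => _ _; apply; exact: (sx i.+1).
Qed.

Definition baire_property (A : set baire) :=
  exists2 O, baire_open O & comeager [set x | A x <-> O x].

Lemma borel_baire_property A : baire_borel A -> baire_property A.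
Proof.
elim => [i a|B _ [O oO cO]|B _ IH].
- exists [set x | x i = a]; first by move=> x /= xa; exists i.+1 => y <-.
  by exists (fun=> setT); split => // j; split => [x _|x n]; [exists 0|exists x].
- pose O' := [set x | exists n, forall y, agree n x y -> ~ O y].
  have oO' : baire_open O'.
    move=> x [n xn]; exists n => y xy; exists n => z yz; apply: xn.
    exact: agree_trans yz.
  exists O' => //.
  have cOO' : comeager (O `|` O').
    exists (fun=> O `|` O'); split; last by move=> x /(_ 0).
    move=> _; split.
      move=> x [/oO|/oO'] [n xn]; exists n => y /xn ?; [by left|by right].
    move=> x n; have [[y [xy Oy]]|H] := pselect (exists y, agree n x y /\ O y).
      by exists y => //; left.
    exists x => //; right; exists n => y xy Oy; apply: H; by exists y.
  apply: comeager_sub (comeagerI cO cOO') => x [/= BO OO']; split.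
    by move=> nB; case: OO' => // /BO.
  by move=> [n xn] /BO; apply: xn.
- have {}IH i : exists O, baire_open O /\ comeager [set x | B i x <-> O x].
    by have [O ? ?] := IH i; exists O.
  have [O OP] := choice IH; exists (\bigcup_i O i).
    move=> x [i _ /(proj1 (OP i))[n xn]]; exists n => y /xn ?; by exists i.
  apply: comeager_sub (comeager_bigcap (fun i => (OP i).2)) => x xB.
  by split => -[i _ /xB ?]; exists i.
Qed.

Definition flip n := if odd n then n.-1 else n.+1.

Lemma flipK : involutive flip.
Proof. by move=> n; rewrite /flip; case: (boolP (odd n)) => /=; case: n => //= n; case: odd. Qed.

Lemma flip_neq n : flip n <> n.
Proof. by rewrite /flip; case: (boolP (odd n)); case: n => //= n; lia. Qed.

Definition twist (r : nat -> nat) (s : nat -> nat -> nat) l (x : baire) : baire :=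
  fun c => if r c < l then x c else flip (x (s l c)).

Lemma twist_agree r s n x : agree n x (twist r s (bound r n) x).
Proof. by move=> i ni; rewrite /twist boundP. Qed.

Lemma twist_cont r s l : baire_cont (twist r s l).
Proof.
apply: baire_cont_coord => x i; rewrite /twist; case: ifP => _.
- by exists i.+1 => y ->.
- by exists (s l i).+1 => y ->.
Qed.

Lemma twist_comeager r s t :
  (forall l c, l <= r c -> l <= r (s l c)) ->
  (forall l c, l <= r c -> t l (s l c) = c) ->
  forall l G, comeager G -> comeager (twist r s l @^-1` G).
Proof.
move=> rs st l G [O [Od OG]]; exists (fun i => twist r s l @^-1` (O i)); split.
  move=> i; split.
    move=> x /(Od i).1[n xn]; have [m xm] := @twist_cont r s l x n.
    by exists m => y /xm/xn.
  move=> x n; pose m := maxn n (bound (t l) n).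
  have [z az Oz] := (Od i).2 (twist r s l x) m.
  pose y d := if r d < l then z d else
    if (s l (t l d) == d) && (l <= r (t l d)) then flip (z (t l d)) else x d.
  have xm c : c < n -> r c < l -> z c = x c.
    by move=> cn cl; rewrite -az ?leq_max ?cn//= /twist cl.
  exists y.
    move=> d dn; rewrite /y; case: ifPn => rd; first by rewrite xm.
    case: ifP => // /andP[/eqP sd rt].
    rewrite -az; last by rewrite leq_max (boundP (t l) dn) orbT.
    by rewrite /twist ltnNge rt/= sd flipK.
  rewrite /preimage /=; suff -> : twist r s l y = z by [].
  apply/funext => c; rewrite /twist; case: ifPn => rc; first by rewrite /y rc.
  rewrite -leqNgt in rc.
  by rewrite /y ltnNge rs//= st// eqxx rc/= flipK.
by move=> x xO; apply: OG => i; apply: xO.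
Qed.

Definition flips := twist id (fun=> id).

Lemma flipsK l : involutive (flips l).
Proof.
by move=> x; apply/funext => c; rewrite /flips /twist; case: ifP => cl; rewrite ?cl ?flipK.
Qed.

Lemma flips_neq l x : flips l x <> x.
Proof.
by move=> /(congr1 (@^~ l)); rewrite /flips /twist ltnn => /flip_neq.
Qed.

Lemma flips_comeager l G : comeager G -> comeager (flips l @^-1` G).
Proof. exact: (@twist_comeager _ _ (fun=> id)). Qed.

Definition paircode (i j : nat) : nat := pickle (i, j).

Definition code_row c := if @pickle_inv (nat * nat)%type c is Some (i, j) then i else 0.

Definition code_col c := if @pickle_inv (nat * nat)%type c is Some (i, j) then j else 0.

Lemma code_rowE i j : code_row (paircode i j) = i.
Proof. by rewrite /code_row pickleK_inv. Qed.

Lemma code_colE i j : code_col (paircode i j) = j.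
Proof. by rewrite /code_col pickleK_inv. Qed.

(* Viewing [x] as the sequence of its rows, [fold l x] keeps the rows of index
   [< l] and decodes all the others from the row of index [l] alone. The entry
   [paircode l 0] is read off itself so that [fold l] has no fixed point. *)
Definition fold := twist code_row (fun l c => if c == paircode l 0 then c else paircode l c.+1).

Lemma fold_comeager l G : comeager G -> comeager (fold l @^-1` G).
Proof.
apply: (@twist_comeager _ _ (fun l d => if d == paircode l 0 then d else (code_col d).-1)).
- by move=> {}l c lc; case: ifP => // _; rewrite code_rowE.
- move=> {}l c lc; case: (eqVneq c (paircode l 0)) => [->|cl]; first by rewrite eqxx.
  case: eqP => [/(congr1 code_col)|_]; first by rewrite !code_colE.
  by rewrite code_colE.
Qed.

Lemma fold_low l x c : code_row c < l -> fold l x c = x c.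
Proof. by rewrite /fold /twist => ->. Qed.

Lemma fold_dep l x y : (forall c, code_row c <= l -> x c = y c) -> fold l x = fold l y.
Proof.
move=> xy; apply/funext => c; rewrite /fold /twist; case: ifPn => rc.
  by rewrite xy// ltnW.
congr flip; case: ifP => [/eqP->|_]; by rewrite xy// code_rowE.
Qed.

Lemma fold_mark l x : fold l x (paircode l 0) = flip (x (paircode l 0)).
Proof. by rewrite /fold /twist code_rowE ltnn eqxx. Qed.

Lemma fold_neq l x : fold l x <> x.
Proof. by move=> /(congr1 (@^~ (paircode l 0))); rewrite fold_mark => /flip_neq. Qed.

Definition evens (x : baire) : baire := x \o double.

Definition odds (x : baire) : baire := x \o (fun n => n.*2.+1).

Definition join (x y : baire) : baire := fun n => if odd n then y n./2 else x n./2.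

Lemma evens_join x y : evens (join x y) = x.
Proof. by apply/funext => n; rewrite /evens /join /= odd_double doubleK. Qed.

Lemma odds_join x y : odds (join x y) = y.
Proof. by apply/funext => n; rewrite /odds /join /= odd_double /= uphalf_double. Qed.

Lemma join_evens_odds x : join (evens x) (odds x) = x.
Proof.
apply/funext => n; rewrite /join /evens /odds /=.
by case: (boolP (odd n)) => on; congr x; lia.
Qed.

Lemma cont_evens : baire_cont evens. Proof. exact: baire_cont_reindex. Qed.

Lemma cont_odds : baire_cont odds. Proof. exact: baire_cont_reindex. Qed.

Lemma baire_closed_preimage f F : baire_cont f -> baire_closed F -> baire_closed (f @^-1` F).
Proof.
move=> cf cF x xl; apply: cF => n; have [m fm] := cf x n.
by have [y xy Fy] := xl m; exists (f y) => //; apply: fm.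
Qed.

Lemma closed_graph_preimage u f g : closed_graph u -> baire_cont f -> baire_cont g ->
  baire_closed [set v | f v = u (g v)].
Proof.
move=> cu cf cg v vl; apply: cu => n; have [m fm] := cf v n; have [k gk] := cg v n.
have [y xy /= fgy] := vl (maxn m k); exists (g y).
  by apply: gk; apply: agree_le xy; apply: leq_maxr.
by rewrite -fgy; apply: fm; apply: agree_le xy; apply: leq_maxl.
Qed.

Lemma baire_borelI A B : baire_borel A -> baire_borel B -> baire_borel (A `&` B).
Proof.
move=> bA bB; rewrite (_ : A `&` B = \bigcap_i (if i is 0 then A else B)).
  by apply: baire_borel_bigcap; case.
apply/seteqP; split => [x [Ax Bx] [|i] _//|x AB].
by split; [exact: (AB 0)|exact: (AB 1)].
Qed.

Section no_common_subgraph.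
Variables (c g0 g1 : baire -> baire) (Fc G : set baire).
Hypotheses (cc : baire_cont c) (cg0 : baire_cont g0) (cg1 : baire_cont g1).
Hypotheses (cFc : baire_closed Fc) (cG : baire_closed G).
Hypothesis irr : forall w v, G w -> Fc v -> g0 w = c v -> g1 w = c v -> False.
Hypothesis inj_evens :
  forall v v', Fc v -> Fc v' -> evens (c v) = evens (c v') -> c v = c v'.
Hypothesis inj_odds :
  forall v v', Fc v -> Fc v' -> odds (c v) = odds (c v') -> c v = c v'.
Hypothesis edge_flips :
  forall w, G w -> exists n, evens (g1 w) = flips n (evens (g0 w)).
Hypothesis edge_fold :
  forall w, G w -> exists l, odds (g1 w) = fold l (odds (g0 w)).

Let label := (nat * nat * seq nat)%type.

(* Codes of the edges of type [(n, l)] between two points of the range of [c],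
   whose source has prescribed entries at the marks [paircode k 0], [k <= l]. *)
Let edges (t : label) : set baire :=
  evens @^-1` G `&` (evens \o odds) @^-1` Fc `&` (odds \o odds) @^-1` Fc `&`
  [set v | g0 (evens v) = c (evens (odds v))] `&`
  [set v | g1 (evens v) = c (odds (odds v))] `&`
  [set v | evens (g1 (evens v)) = flips t.1.1 (evens (g0 (evens v)))] `&`
  [set v | odds (g1 (evens v)) = fold t.1.2 (odds (g0 (evens v)))] `&`
  [set v | forall k : 'I_t.1.2.+1,
     odds (g0 (evens v)) (paircode k 0) = nth 0 t.2 k].

Let closed_edges t : baire_closed (edges t).
Proof.
have ce := cont_evens; have co := cont_odds; have cC := baire_cont_comp.
have cg0e := cC _ _ cg0 ce; have cg1e := cC _ _ cg1 ce.
repeat apply: baire_closedI.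
- exact: baire_closed_preimage.
- by apply: baire_closed_preimage => //; apply: cC.
- by apply: baire_closed_preimage => //; apply: cC.
- by apply: baire_closed_eq => //; exact: (cC _ _ cc (cC _ _ ce co)).
- by apply: baire_closed_eq => //; exact: (cC _ _ cc (cC _ _ co co)).
- apply: baire_closed_eq; first exact: (cC _ _ ce cg1e).
  exact: (cC _ _ (@twist_cont _ _ t.1.1) (cC _ _ ce cg0e)).
- apply: baire_closed_eq; first exact: (cC _ _ co cg1e).
  exact: (cC _ _ (@twist_cont _ _ t.1.2) (cC _ _ co cg0e)).
- apply: (@baire_closed_forall _ (fun k : 'I_t.1.2.+1 => [set v | odds (g0 (evens v)) (paircode k 0) = nth 0 t.2 k])) => k.
  by apply: (@baire_closed_coord (odds \o (g0 \o evens))); exact: (cC _ _ co cg0e).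
Qed.

(* On [edges (n, l, s)] the rows [<= l] of the odd part determine the source, so an
   edge of [fold l'] with [l < l'] between two sources would be a loop, while for
   [l' <= l] it would change the entry at the mark [paircode l' 0]. *)
Let sources_independent t v v' w : edges t v -> edges t v' -> G w ->
  g0 w = g0 (evens v) -> g1 w = g0 (evens v') -> False.
Proof.
move=> [[[[[[[Gv Fv1] Fv2] v0] v1] vn] vl] vs].
move=> [[[[[[[Gv' Fv1'] Fv2'] v0'] v1'] vn'] vl'] vs'] Gw w0 w1.
have [l wl] := edge_fold Gw.
have [tl|lt] := ltnP t.1.2 l.
  have e : fold t.1.2 (odds (g0 (evens v))) = fold t.1.2 (odds (g0 (evens v'))).
    apply: fold_dep => k kt; rewrite -w1 wl w0 fold_low//.
    exact: leq_ltn_trans tl.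
  have e1 : g1 (evens v) = g1 (evens v').
    by rewrite v1 v1'; apply: inj_odds => //; rewrite -v1 -v1' vl vl'.
  have e0 : g0 (evens v) = g0 (evens v').
    rewrite v0 v0'; apply: inj_evens => //; rewrite -v0 -v0'.
    by apply: (can_inj (flipsK t.1.1)); rewrite -vn -vn' e1.
  by apply: (irr Gw Fv1); rewrite ?w0 ?w1 -?e0.
have := vs (Ordinal (lt : l < t.1.2.+1)); have := vs' (Ordinal (lt : l < t.1.2.+1)).
by rewrite /= -w1 wl fold_mark -w0 => <- /esym/flip_neq.
Qed.

Lemma diagonal_covered : exists P Q : nat -> set baire,
  [/\ forall j, baire_borel (P j), forall j, baire_borel (Q j),
      forall v, Fc v -> exists j, P j (c v) /\ Q j (c v) &
      forall j w, G w -> P j (g0 w) -> Q j (g1 w) -> False].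
Proof.
have cg0e := baire_cont_comp cg0 cont_evens.
have sep t : exists R, [/\ baire_borel R, forall v, edges t v -> R (g0 (evens v)) &
    forall w, G w -> R (g0 w) -> R (g1 w) -> False].
  have [P [Q [bP bQ EP EQ PQ]]] := rectangle_separation cg0e cg0e cg0 cg1
    (@closed_edges t) (@closed_edges t) cG (@sources_independent t).
  exists (P `&` Q); split; first exact: baire_borelI.
    by move=> v Ev; split; [apply: EP|apply: EQ].
  by move=> w Gw [Pw _] [_ Qw]; apply: (PQ w).
have [R RP] := choice sep.
pose Rn j := if @unpickle label j is Some t then R t else set0.
have bRn j : baire_borel (Rn j).
  rewrite /Rn; case: unpickle => [t|]; last exact: baire_borel0.
  by case: (RP t).
pose W := \bigcup_j Rn j.
have bW : baire_borel W by exact: baire_borel_bigcup.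
have [u [cu uW]] := borel_encoded bW.
have ce := cont_evens; have co := cont_odds.
have cce := baire_cont_comp cc ce.
pose F := evens @^-1` Fc `&` [set v | odds v = u (c (evens v))] `&`
  [set v | odds v 0 = 0].
have cF : baire_closed F.
  apply: baire_closedI; last exact: baire_closed_coord.
  by apply: baire_closedI;
    [exact: baire_closed_preimage|exact: closed_graph_preimage cce].
have [|P [Q [bP bQ FP FQ PQ]]] := rectangle_separation cce cc cg0 cg1 cF cFc cG.
  move=> v v' w [[/= Fv vu] v0] Fv' Gw w0 w1.
  have [n wn] := edge_flips Gw; have [l wl] := edge_fold Gw.
  pose s := mkseq (fun k => odds (g0 w) (paircode k 0)) l.+1.
  pose x := join w (join (evens v) v').
  have Ex : edges (n, l, s) x.
    rewrite /edges /= /x; split; last by move=> k; rewrite evens_join nth_mkseq.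
    by do !split => /=; rewrite ?odds_join ?evens_join ?odds_join.
  have : W (c (evens v)).
    exists (pickle ((n, l, s) : label)) => //; rewrite /Rn pickleK.
    have [_ /(_ _ Ex) + _] := RP (n, l, s).
    by rewrite /x evens_join w0.
  by move=> /uW; rewrite -vu v0.
exists (fun j => if j is j'.+1 then Rn j' else P).
exists (fun j => if j is j'.+1 then Rn j' else Q); split.
- by case.
- by case.
- move=> v Fv; have [[j _ Rj]|nW] := pselect (W (c v)); first by exists j.+1.
  exists 0; split; last exact: FQ.
  have := FP (join v (u (c v))); rewrite /F /preimage /= evens_join odds_join; apply.
  split => //; apply: contrapT => H; apply: nW; exact/uW.
- move=> [|j] w Gw; first exact: PQ.
  rewrite /Rn; case: unpickle => // t; by case: (RP t) => _ _; apply.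
Qed.

End no_common_subgraph.

Lemma exists_natSinv_lt (R : realType) (e : R) : (0 < e)%R ->
  exists n, (n.+1%:R^-1 < e)%R.
Proof.
move=> e0; exists (Num.truncn e^-1); rewrite invf_plt ?posrE//.
exact: truncnS_gt.
Qed.

Section first_difference.
Variable R : realType.

Definition first_diff_dist (x y : baire) : R :=
  if pselect (exists i, x i != y i) is left h then ((ex_minn h).+1%:R^-1)%R else 0%R.

Lemma first_diff_dist_le x y n :
  (first_diff_dist x y <= n.+1%:R^-1)%R <-> agree n x y.
Proof.
rewrite /first_diff_dist; case: pselect => [h|h]; last first.
  split => _; last by rewrite invr_ge0.
  by move=> i _; apply: contrapT => /eqP xy; apply: h; exists i.
case: ex_minnP => m xm mmin; rewrite lef_pV2 ?posrE// ler_nat ltnS; split.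
  move=> nm i ni; apply/eqP/negPn/negP => /mmin; rewrite leqNgt => /negP; apply.
  exact: leq_trans nm.
by move=> xy; rewrite leqNgt; apply/negP => /xy/eqP; apply/negP.
Qed.

Lemma first_diff_dist_ge0 x y : (0 <= first_diff_dist x y)%R.
Proof. by rewrite /first_diff_dist; case: pselect => // h; rewrite invr_ge0. Qed.

Lemma first_diff_dist_gt0 x y : (0 < first_diff_dist x y)%R ->
  exists n, first_diff_dist x y = (n.+1%:R^-1)%R.
Proof.
rewrite /first_diff_dist; case: pselect => [h _|h]; last by rewrite ltxx.
by eexists.
Qed.

Lemma first_diff_dist0 x y : first_diff_dist x y = 0%R -> x = y.
Proof.
move=> d0; apply: agreeP => n; apply/first_diff_dist_le.
by rewrite d0 invr_ge0.
Qed.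

Lemma first_diff_distxx x : first_diff_dist x x = 0%R.
Proof.
by rewrite /first_diff_dist; case: pselect => // h; exfalso; case: h => i; rewrite eqxx.
Qed.

Lemma first_diff_dist_sym x y : first_diff_dist x y = first_diff_dist y x.
Proof.
have le x' y' : (first_diff_dist x' y' <= first_diff_dist y' x')%R.
  have := first_diff_dist_ge0 y' x'; rewrite le_eqVlt => /predU1P[/esym/first_diff_dist0 ->//|].
  move=> /first_diff_dist_gt0[n dn]; rewrite dn; apply/first_diff_dist_le/agree_sym.
  by apply/first_diff_dist_le; rewrite dn.
by apply/eqP; rewrite eq_le !le.
Qed.

Lemma first_diff_dist_triangle y x z :
  (first_diff_dist x z <= first_diff_dist x y + first_diff_dist y z)%R.
Proof.
wlog xy : x z / (first_diff_dist x y <= first_diff_dist y z)%R.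
  move=> H; have [/H//|/ltW] := leP (first_diff_dist x y) (first_diff_dist y z).
  rewrite first_diff_dist_sym (first_diff_dist_sym x y) => /H.
  by rewrite addrC (first_diff_dist_sym z) .
have := first_diff_dist_ge0 y z; rewrite le_eqVlt => /predU1P[/esym yz|].
  by rewrite (first_diff_dist0 yz) first_diff_distxx addr0.
move=> /first_diff_dist_gt0[n dn].
apply: le_trans (_ : first_diff_dist y z <= _)%R; last first.
  by rewrite lerDr first_diff_dist_ge0.
rewrite dn; apply/first_diff_dist_le; apply: (@agree_trans _ y).
  by apply/first_diff_dist_le; rewrite -dn.
by apply/first_diff_dist_le; rewrite dn.
Qed.

End first_difference.

(* The topology induced on [T] by an injection into the Baire space. The
   parameter [R] only serves to make the metric structure canonical. *)
Definition coded (R : realType) (T : Type) (e : T -> baire) (inj_e : injective e) :=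
  T.

Section coded.
Variables (R : realType) (T : Type) (e : T -> baire) (inj_e : injective e).
Local Notation X := (coded R inj_e).

HB.instance Definition _ := gen_eqMixin X.
HB.instance Definition _ := gen_choiceMixin X.

Let dist (x y : X) : R := first_diff_dist R (e x) (e y).

Let distxx x : dist x x = 0%R. Proof. exact: first_diff_distxx. Qed.

Let dist_positivity x y : dist x y = 0%R -> x = y.
Proof. by move=> /first_diff_dist0/inj_e. Qed.

Let dist_sym x y : dist x y = dist y x. Proof. exact: first_diff_dist_sym. Qed.

Let dist_triangle y x z : (dist x z <= dist x y + dist y z)%R.
Proof. exact: first_diff_dist_triangle. Qed.

HB.instance Definition _ :=
  isMetric.Build R X distxx dist_positivity dist_sym dist_triangle.

Lemma coded_ball (x y : X) n : ball x (n.+1%:R^-1 : R)%R y -> agree n (e x) (e y).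
Proof.
by rewrite ballEmdist /= => xy; apply/(first_diff_dist_le R)/ltW.
Qed.

Lemma coded_nbhs (x : X) (A : set X) :
  nbhs x A <-> exists n, forall y : X, agree n (e x) (e y) -> A y.
Proof.
split.
  move=> /nbhs_ballP[r /= r0 rA]; have [n nr] := exists_natSinv_lt r0.
  exists n => y xy; apply: rA; rewrite ballEmdist /=; apply: le_lt_trans nr.
  exact/first_diff_dist_le.
move=> [n nA]; apply/nbhs_ballP; exists (n.+1%:R^-1)%R; first by rewrite /= invr_gt0 ltr0n.
by move=> y /coded_ball; apply: nA.
Qed.

Lemma coded_open (U : set X) :
  open U <-> forall x, U x -> exists n, forall y : X, agree n (e x) (e y) -> U y.
Proof.
rewrite openE; split => [oU x /oU /coded_nbhs//|H x /H ?]; exact/coded_nbhs.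
Qed.

Lemma coded_clopen (x : X) n : clopen [set y : X | agree n (e x) (e y)].
Proof.
split.
  by apply/coded_open => y /= xy; exists n => z; apply: agree_trans xy.
rewrite -[X in closed X]setCK; apply: open_closedC; apply/coded_open => y /= nxy.
exists n => z yz xz; apply: nxy; apply: agree_trans xz _; exact: agree_sym.
Qed.

Lemma coded_clopen_basis : clopen_basis X.
Proof.
split => [U []//|x A /coded_nbhs[n nA]].
by exists [set y : X | agree n (e x) (e y)] => //; split => //; apply: coded_clopen.
Qed.

Lemma coded_separable : separable X.
Proof.
pose D s := [set x : X | exists h : (exists y : X, agree (size s) (nth 0 s) (e y)),
  x = projT1 (cid h)].
exists (\bigcup_(s in [set: seq nat]) D s).
  apply: bigcup_countable => // s _.
  have [h|h] := pselect (exists y : X, agree (size s) (nth 0 s) (e y)).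
    apply: sub_countable (countable1 (projT1 (cid h))); apply: subset_card_le.
    by move=> x [h' ->]; rewrite /= (Prop_irrelevance h' h).
  apply: sub_countable (countable0 X); apply: subset_card_le.
  by move=> x [h' _]; apply: h.
move=> O [x Ox] /coded_open/(_ x Ox)[n nO].
pose s := mkseq (e x) n.
have h : exists y : X, agree (size s) (nth 0 s) (e y).
  by exists x => i; rewrite size_mkseq => ni; rewrite nth_mkseq.
exists (projT1 (cid h)); split; last by exists s => //; exists h.
apply: nO => i ni; case: cid => y /= ys.
by rewrite -ys ?size_mkseq// nth_mkseq.
Qed.

Lemma coded_complete : baire_closed (range e) -> complete_metric (X : metricType R).
Proof.
move=> ce F FF /cauchyP cF.
have H n : exists x : X, F [set y : X | agree n (e x) (e y)].
  have [|x Fx] := cF (n.+1%:R^-1)%R; first by rewrite invr_gt0.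
  by exists x; apply: filterS Fx => y /coded_ball.
have [x Fx] := choice H.
have xx m n : m <= n -> agree m (e (x m)) (e (x n)).
  move=> mn; have [y [xmy xny]] := filter_ex (filterI (Fx m) (Fx n)).
  apply: agree_trans xmy _; apply: agree_sym; exact: agree_le mn xny.
have xl := agree_limit (fun n => xx n n.+1 (leqnSn n)).
have [|y _ ey] := ce (fun i => e (x i.+1) i).
  by move=> n; exists (e (x n)); [exact/agree_sym/xl|exists (x n)].
exists y => A /coded_nbhs[n nA]; apply: filterS (Fx n) => z xz; apply: nA.
rewrite ey; apply: agree_trans xz; exact/agree_sym/xl.
Qed.

Lemma coded_polish : baire_closed (range e) -> polish R X.
Proof.
move=> ce; split; first exact: coded_separable.
by exists (Metric.class X); split => //; exact: coded_complete.
Qed.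

End coded.

Section metric_space.
Variables (R : realType) (M : metricType R).
Local Notation dist := (@mdist R M).
Variable d : nat -> M.
Hypothesis dense_d : forall y (r : R), (0 < r)%R -> exists n, (dist y (d n) < r)%R.

Let a n : R := ((2 ^ n)%:R^-1)%R.

Let a_gt0 n : (0 < a n)%R. Proof. by rewrite invr_gt0 ltr0n expn_gt0. Qed.

Let aS n : (a n = a n.+1 + a n.+1)%R.
Proof.
by rewrite /a expnS natrM invfM mulrC -splitr.
Qed.

Let a_small (r : R) : (0 < r)%R -> exists n, (a n < r)%R.
Proof.
move=> /exists_natSinv_lt[n nr]; exists n; apply: le_lt_trans nr.
by rewrite lef_pV2 ?posrE ?ltr0n ?expn_gt0// ler_nat ltn_expl.
Qed.

Let mdist_open (x : M) (r : R) : open [set y | (dist x y < r)%R].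
Proof.
rewrite openE => y /= xy; apply/nbhs_ballP; exists (r - dist x y)%R => /=.
  by rewrite subr_gt0.
move=> z; rewrite ballEmdist /= => yz; have := metric_triangle x y z; lra.
Qed.

Lemma metric_countable_basis : exists U : nat -> set M,
  (forall i, open (U i)) /\
  forall x O, open O -> O x -> exists i, U i x /\ U i `<=` O.
Proof.
exists (fun c => [set y | (dist (d (code_row c)) y < a (code_col c))%R]); split.
  by move=> c; exact: mdist_open.
move=> x O; rewrite openE => oO /oO /nbhs_ballP[r /= r0 rO].
have [n nr] := a_small r0; have [i xi] := dense_d x (a_gt0 n.+1).
exists (paircode i n.+1); rewrite code_rowE code_colE; split => /=.
  by rewrite metric_sym.
move=> y /= iy; apply: rO; rewrite ballEmdist /=.
have := metric_triangle x (d i) y; have := aS n; lra.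
Qed.

Let Fixpoint approx (w : baire) (n : nat) : M := if n is n'.+1 then
  if (dist (approx w n') (d (w n)) < a n')%R then d (w n) else approx w n'
  else d (w 0).

Let approxS w n : (dist (approx w n) (approx w n.+1) < a n)%R.
Proof. by rewrite /=; case: ifP => // _; rewrite mdistxx. Qed.

Let approxD w n k :
  (dist (approx w n) (approx w (n + k)) <= a n + a n - (a (n + k) + a (n + k)))%R.
Proof.
elim: k => [|k IH]; first by rewrite addn0 mdistxx subrr.
have := metric_triangle (approx w n) (approx w (n + k)) (approx w (n + k.+1)).
by rewrite addnS; have := approxS w (n + k); have := aS (n + k); lra.
Qed.

Let approx_le w n k : n <= k -> (dist (approx w n) (approx w k) <= a n + a n)%R.
Proof.
move=> nk; rewrite -(subnKC nk); have := approxD w n (k - n).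
have := a_gt0 (n + (k - n)); lra.
Qed.

Lemma metric_baire_image : complete_metric M -> exists p : baire -> M,
  (forall w U, open U -> U (p w) -> exists n, forall w', agree n w w' -> U (p w')) /\
  forall y, exists w, p w = y.
Proof.
move=> complM.
have lim w : exists y, forall n, (dist (approx w n) y <= a n + a n)%R.
  have cF : cauchy (approx w @ \oo).
    apply: cauchy_exP => r r0; have [n nr] := a_small r0.
    exists (approx w n.+1); exists n.+1 => // k nk.
    have : (dist (approx w n.+1) (approx w k) < r)%R.
      by apply: le_lt_trans nr; rewrite (aS n); apply: approx_le.
    by rewrite /preimage ballEmdist.
  have [y wy] := complM _ _ cF; exists y => n; apply/ler_addgt0Pr => r r0.
  have [N _ Nr] := wy _ (nbhsx_ballx y r r0).
  have := Nr (maxn n N) (leq_maxr _ _); rewrite /= ballEmdist /= metric_sym.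
  have := approx_le w (leq_maxl n N).
  have := metric_triangle (approx w n) (approx w (maxn n N)) y; lra.
have [p pP] := choice lim; exists p; split.
  move=> w U; rewrite openE => oU /oU /nbhs_ballP[r /= r0 rU].
  have [n nr] := a_small r0; exists n.+3 => w' ww'; apply: rU.
  have e : approx w n.+2 = approx w' n.+2.
    elim: n.+2 ww' => [|m IH] ww'; first by rewrite /= ww'.
    by rewrite /= IH ?ww'//; apply: agree_le ww'.
  rewrite ballEmdist /=; have := metric_triangle (p w) (approx w n.+2) (p w').
  have := pP w n.+2; have := pP w' n.+2; rewrite -e (metric_sym _ (p w)).
  have := aS n; have := aS n.+1; have := aS n.+2; have := a_gt0 n.+2.
  rewrite metric_sym; lra.
move=> y; have [w yw] := choice (fun n => dense_d y (a_gt0 n.+1)).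
exists w; apply/esym/mdist_positivity/eqP; rewrite eq_le mdist_ge0 andbT.
have e n : approx w n = d (w n).
  elim: n => // n IH; rewrite /= IH ifT//.
  have := metric_triangle (d (w n)) y (d (w n.+1)).
  have := yw n; have := yw n.+1; have := aS n; have := aS n.+1.
  have := a_gt0 n.+2; rewrite (metric_sym _ y); lra.
apply/ler_addgt0Pr => r /a_small[n nr]; rewrite add0r.
have := metric_triangle y (approx w n.+2) (p w); have := pP w n.+2.
have := yw n.+2; rewrite -e.
have := aS n; have := aS n.+1; have := aS n.+2; have := a_gt0 n.+3; lra.
Qed.

End metric_space.

Lemma countable_dense_enum (R : realType) (M : metricType R) (y0 : M) (D : set M) :
  countable D -> dense D ->
  exists d : nat -> M, forall y (r : R), (0 < r)%R -> exists n, (mdist y (d n) < r)%R.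
Proof.
move=> /countable_injP[f injf] dD.
have H n : exists x, forall z, D z -> f z = n -> x = z.
  have [[z [Dz fz]]|nz] := pselect (exists z, D z /\ f z = n); last first.
    by exists y0 => z Dz fz; exfalso; apply: nz; exists z.
  by exists z => z' Dz' fz'; apply: injf; rewrite ?inE// fz fz'.
have [d dP] := choice H; exists d => y r r0.
have [||z [/= yz Dz]] := dD (interior (ball y r)).
- by exists y; exact: nbhsx_ballx.
- exact: open_interior.
exists (f z); rewrite (dP _ _ Dz erefl).
by have := interior_subset yz; rewrite ballEmdist.
Qed.

Lemma polish_countable_basis (R : realType) (Y : topologicalType) : polish R Y ->
  exists U : nat -> set Y, (forall i, open (U i)) /\
    forall x O, open O -> O x -> exists i, U i x /\ U i `<=` O.
Proof.
move=> [[D cD dD] [m [oM cM]]].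
have [[y0 _]|nY] := pselect (exists y : Y, True); last first.
  by exists (fun=> set0); split => [_|x]; [exact: open0|exfalso; apply: nY; exists x].
have [d dP] : exists d : nat -> (Metric.Pack m : metricType R),
    forall y (r : R), (0 < r)%R -> exists n, (mdist y (d n) < r)%R.
  apply: (@countable_dense_enum R (Metric.Pack m) y0 D cD).
  by move=> O O0 /oM; apply: dD.
have [U [oU UP]] := metric_countable_basis dP.
by exists U; split => [i|x O /oM]; [exact/oM|exact: UP].
Qed.

Lemma polish_baire_image (R : realType) (Y : topologicalType) (y0 : Y) : polish R Y ->
  exists p : baire -> Y,
  (forall w U, open U -> U (p w) -> exists n, forall w', agree n w w' -> U (p w')) /\
  forall y, exists w, p w = y.
Proof.
move=> [[D cD dD] [m [oM cM]]].
have [d dP] : exists d : nat -> (Metric.Pack m : metricType R),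
    forall y (r : R), (0 < r)%R -> exists n, (mdist y (d n) < r)%R.
  apply: (@countable_dense_enum R (Metric.Pack m) y0 D cD).
  by move=> O O0 /oM; apply: dD.
have [p [cp sp]] := metric_baire_image dP cM.
by exists p; split => // w U /oM; exact: cp.
Qed.

Definition baire_space (R : realType) : topologicalType :=
  coded R (@inj_id baire).

Lemma polish_baire_space (R : realType) : polish R (baire_space R).
Proof. by apply: coded_polish => x _; exists x. Qed.

Lemma continuous_agree (R : realType) (Y : topologicalType) (f : Y -> baire) :
  continuous (f : Y -> baire_space R) <->
  forall y n, nbhs y [set y' | agree n (f y) (f y')].
Proof.
split => [cf y n|H y A /coded_nbhs[n nA]].
  by apply: (cf y); apply/coded_nbhs; exists n.
by apply: filterS (H y n) => y' /nA.
Qed.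

Lemma baire_cont_continuous (R : realType) (f : baire -> baire) :
  baire_cont f -> continuous (f : baire_space R -> baire_space R).
Proof.
move=> cf; apply/(@continuous_agree R (baire_space R)) => x n; apply/coded_nbhs.
exact: cf.
Qed.

Lemma analytic_baire_space (R : realType)
    (A : set (prod_space (baire_space R) (baire_space R))) : analytic R A ->
  exists g0 g1 G, [/\ baire_cont g0, baire_cont g1, baire_closed G &
    forall x y, A (x, y) <-> exists2 w, G w & x = g0 w /\ y = g1 w].
Proof.
move=> [Y [f [pY cf rf]]].
have [[y0 _]|nY] := pselect (exists y : Y, True); last first.
  exists id, id, set0; split; try by move=> x n; exists n.
    by move=> x /(_ 0)[].
  move=> x y; split => [|[w []]]; rewrite -rf => -[y' _ _].
  by exfalso; apply: nY; exists y'.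
have [p [cp sp]] := polish_baire_image y0 pY.
have cg (pr : baire * baire -> baire) :
    (forall z n, nbhs (z : prod_space (baire_space R) (baire_space R))
       [set z' | agree n (pr z) (pr z')]) ->
    baire_cont (fun w => pr (f (p w))).
  move=> npr x n; have := cf (p x) _ (npr (f (p x)) n).
  rewrite /= /fmap /= nbhsE => -[U [oU Ux] UA].
  have [m mU] := cp x U oU Ux; exists m => y /mU; exact: UA.
exists (fun w => (f (p w)).1), (fun w => (f (p w)).2), setT; split => //.
- apply: (cg fst) => z n.
  exists ([set x | agree n z.1 x], setT) => [|[x y] []//]; split => /=.
    by apply/coded_nbhs; exists n.
  exact: filterT.
- apply: (cg snd) => z n.
  exists (setT, [set x | agree n z.2 x]) => [|[x y] []//]; split => /=.
    exact: filterT.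
  by apply/coded_nbhs; exists n.
- move=> x y; rewrite -rf; split => [[y' _ fy]|[w _ [-> ->]]].
    by have [w wy] := sp y'; exists w => //; rewrite wy fy.
  by exists (p w) => //; case: (f _).
Qed.

Lemma finer_open_borel (R : realType) (t : Topological (baire_space R)) :
  finer_zero_dim_polish R t ->
  forall U, @open (Topological.Pack t) U -> baire_borel U.
Proof.
move=> [fin pt _] U oU.
have [p [cp sp]] := polish_baire_image ((fun=> 0) : Topological.Pack t) pt.
have cp' : baire_cont p.
  move=> x n; apply: (cp x [set y | agree n (p x) y]) => //.
  by apply: fin; apply/coded_open => y /= xy; exists n => z; apply: agree_trans xy.
have cs : baire_cont shift by exact: (@baire_cont_reindex succn).
have cid : baire_cont id by move=> x n; exists n.
pose F := [set w : baire | forall w', agree (w 0) (shift w) w' -> U (p w')].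
have cF : baire_closed F.
  move=> x xl w' xw'; have [y xy] := xl (x 0).+1; rewrite /F /= -xy//; apply.
  by move=> i ix; rewrite /shift -xy//; apply: xw'.
have cG : baire_closed [set w : baire | ~ U (p w)].
  move=> x xl Ux; have [n nU] := cp x U oU Ux; have [y xy] := xl n; apply.
  exact: nU.
have cT : baire_closed setT by [].
have [|P [Q [bP _ FP FQ PQ]]] :=
    rectangle_separation (baire_cont_comp cp' cs) cid cp' cp' cF cT cG.
  move=> w w' v Fw _ /= nUv e _; apply: nUv; rewrite e; exact: Fw.
suff -> : U = P by [].
apply/seteqP; split => x.
  have [w <-] := sp x => Uw; have [n nU] := cp w U oU Uw.
  by have := FP (consN n w); apply => w'; apply: nU.
have [w <-] := sp x => Pw; apply: contrapT => nU; apply: (PQ w) => //; exact: FQ.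
Qed.

Definition functions_graph (R : realType) (H : nat -> baire -> baire) :
    set (prod_space (baire_space R) (baire_space R)) :=
  [set z | exists l, z.2 = H l z.1].
Arguments functions_graph : clear implicits.

Definition baire_diagonal (R : realType) :
    set (prod_space (baire_space R) (baire_space R)) := [set z | z.1 = z.2].
Arguments baire_diagonal : clear implicits.

Lemma functions_graph_nonseparable (R : realType) (H : nat -> baire -> baire) :
  (forall l G, comeager G -> comeager (H l @^-1` G)) ->
  (forall n, exists l, forall x, agree n x (H l x)) ->
  ~ pot_closed_separable R (functions_graph R H) (baire_diagonal R).
Proof.
move=> Hcom Hag [B [[_ [t0 [t1 [f0 f1 cB]]]] HB B1]].
have [U [oU UP]] : exists U : nat -> set (Topological.Pack t0), _ :=
  polish_countable_basis (let: And3 _ p _ := f0 in p).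
have [V [oV VP]] : exists V : nat -> set (Topological.Pack t1), _ :=
  polish_countable_basis (let: And3 _ p _ := f1 in p).
have bp0 i : exists O, baire_open O /\ comeager [set x | U i x <-> O x].
  have [O ? ?] := borel_baire_property (finer_open_borel f0 (oU i)).
  by exists O.
have bp1 i : exists O, baire_open O /\ comeager [set x | V i x <-> O x].
  have [O ? ?] := borel_baire_property (finer_open_borel f1 (oV i)).
  by exists O.
have [O OP] := choice bp0; have [O' OP'] := choice bp1.
have cG := comeagerI (comeager_bigcap (fun i => (OP i).2))
  (comeager_bigcap (fun i => (OP' i).2)).
move: cG; set G := _ `&` _ => cG.
have [x _ [Gx Gx']] := comeager_dense cG (fun=> 0) 0.
have nBx : ~ B (x, x).
  by move=> Bx; suff : set0 (x, x) by []; rewrite -B1; split.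
have [[U0 V0] [/= nU0 nV0] UV] :
    @nbhs _ (prod_space (Topological.Pack t0) (Topological.Pack t1)) (x, x) (~` B).
  have := closed_openC cB; rewrite openE; apply; exact: nBx.
move: nU0 nV0; rewrite (@nbhsE (Topological.Pack t0) x).
rewrite (@nbhsE (Topological.Pack t1) x) => -[U1 [oU1 U1x] U10] [V1 [oV1 V1x] V10].
have [i [Uix Ui]] := UP x U1 oU1 U1x; have [j [Vjx Vj]] := VP x V1 oV1 V1x.
have [n nO] := (OP i).1 x ((Gx i).1 Uix).
have [m mO] := (OP' j).1 x ((Gx' j).1 Vjx).
have [l Hl] := Hag (maxn n m).
have [y xy [[Gy _] [_ GHy]]] := comeager_dense (comeagerI cG (Hcom l G cG)) x (maxn n m).
have : B (y, H l y) by apply: HB; exists l.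
apply: (UV (y, H l y)); split => /=.
- apply/U10/Ui/(Gy i)/nO; exact: agree_le (leq_maxl _ _) xy.
- apply/V10/Vj/(GHy j)/mO; apply: agree_le (leq_maxr n m) _.
  exact: agree_trans xy (Hl y).
Qed.

Lemma continuous_pair_space (Y X0 X1 : topologicalType) (f : Y -> X0) (g : Y -> X1) :
  continuous f -> continuous g ->
  continuous (fun y => (f y, g y) : prod_space X0 X1).
Proof. by move=> cf cg y; apply: cvg_pair; [exact: cf|exact: cg]. Qed.

Lemma functions_graph_pair (R : realType) (H : nat -> baire -> baire) :
  (forall l, baire_cont (H l)) -> (forall l x, H l x <> x) ->
  disjoint_analytic_pair R (functions_graph R H) (baire_diagonal R).
Proof.
move=> cH Hn; have pN := polish_baire_space R; split => //.
- exists (baire_space R), (fun w => (shift w, H (w 0) (shift w))); split => //.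
    apply: continuous_pair_space; apply: baire_cont_continuous.
      exact: (@baire_cont_reindex succn).
    move=> x n; have [m xm] := cH (x 0) (shift x) n; exists m.+1 => y xy.
    by rewrite -(xy 0)//; apply: xm => i im; rewrite /shift xy.
  apply/seteqP; split => [_ [w _ <-]|[x y] [l /= ->]]; first by exists (w 0).
  by exists (consN l x).
- exists (baire_space R), (fun w => (w, w)); split => //.
    by apply: continuous_pair_space => x.
  apply/seteqP; split => [_ [w _ <-]//|[x y] xy].
  by exists y => //; rewrite (xy : x = y).
- by apply/seteqP; split => // -[x y] [[l /= ->]] /esym/Hn.
Qed.

Section borel_sets.
Variable T : topologicalType.
Implicit Types A B : set T.

Lemma borel_open A : open A -> borel A.
Proof. exact: sub_sigma_algebra. Qed.

Lemma borelC A : borel A -> borel (~` A).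
Proof. by move=> bA; rewrite -setTD; apply: sigma_algebraCD. Qed.

Lemma borel_bigcup (A : nat -> set T) : (forall i, borel (A i)) -> borel (\bigcup_i A i).
Proof. exact: sigma_algebra_bigcup. Qed.

Lemma borelI A B : borel A -> borel B -> borel (A `&` B).
Proof.
move=> bA bB; rewrite -[_ `&` _]setCK setCI -bigcup2E; apply: borelC.
apply: borel_bigcup => -[|[|i]] /=; [exact: borelC|exact: borelC|].
by apply: borel_open; exact: open0.
Qed.

End borel_sets.

Lemma baire_borel_preimage (R : realType) (T : topologicalType)
    (f : T -> baire_space R) A :
  continuous f -> baire_borel A -> borel (f @^-1` A).
Proof.
move=> cf; elim => [i a|B _ bB|B _ bB].
- apply: borel_open; apply: open_comp; first by move=> *; exact: cf.
  by apply/coded_open => x /= <-; exists i.+1 => y /(_ i (ltnSn i)).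
- by rewrite preimage_setC; apply: borelC.
- by rewrite preimage_bigcup; apply: borel_bigcup.
Qed.

Lemma borel_finer_topology (R : realType) (P : nat -> set baire) :
  (forall j, baire_borel (P j)) ->
  exists t : Topological (baire_space R), finer_zero_dim_polish R t /\
    forall j, @open (Topological.Pack t) (P j).
Proof.
move=> bP; have [u uP] := choice (fun j => borel_encoded (bP j)).
have cu := closed_graph_interleave (fun j => (uP j).1).
pose e (z : baire_space R) := join z (interleave u z).
have inj_e : injective e.
  by move=> x y /(congr1 evens); rewrite !evens_join.
have ce : baire_closed (range e).
  move=> w wl; exists (evens w) => //; rewrite /e -[RHS]join_evens_odds.
  congr join; apply/esym/cu => n; have [m em] := cont_evens w n.
  have [k ok] := cont_odds w n; have [v wz [z _ ez]] := wl (maxn m k).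
  exists z.
    rewrite -[z](evens_join z (interleave u z)) -/(e z) ez; apply: em.
    exact: agree_le (leq_maxl _ _) wz.
  rewrite -[interleave u z](odds_join z) -/(e z) ez; apply: ok.
  exact: agree_le (leq_maxr _ _) wz.
exists (Topological.class (coded R inj_e)); split.
  split.
  - move=> U /coded_open oU; apply/(@coded_open R _ e inj_e) => x /oU[n nU].
    exists n.*2 => y xy; apply: nU => i ni; have := xy i.*2.
    by rewrite /e /join odd_double doubleK ltn_double; apply.
  - exact: (@coded_polish R _ e inj_e ce).
  - exact: (@coded_clopen_basis R _ e inj_e).
move=> j; apply/(@coded_open R _ e inj_e) => x /(proj2 (uP j)) ux.
exists (paircode j 0).*2.+2 => y xy; apply/(proj2 (uP j)).
have := xy (paircode j 0).*2.+1; rewrite /e /join /= odd_double /= uphalf_double.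
by rewrite !interleaveE => <-.
Qed.

Lemma borel_cover_separable (R : realType)
    (A0 A1 : set (prod_space (baire_space R) (baire_space R)))
    (P Q : nat -> set baire) :
  (forall j, baire_borel (P j)) -> (forall j, baire_borel (Q j)) ->
  (forall z, A1 z -> exists j, P j z.1 /\ Q j z.2) ->
  (forall j z, A0 z -> P j z.1 -> Q j z.2 -> False) ->
  pot_closed_separable R A0 A1.
Proof.
move=> bP bQ cov dis.
pose C := \bigcup_j (fst @^-1` P j `&` snd @^-1` Q j) :
  set (prod_space (baire_space R) (baire_space R)).
exists (~` C); split.
- split.
    apply: borelC; apply: borel_bigcup => j; apply: borelI.
      apply: (@baire_borel_preimage R) (bP j) => z; exact: cvg_fst.
    apply: (@baire_borel_preimage R) (bQ j) => z; exact: cvg_snd.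
  have [t0 [f0 o0]] := borel_finer_topology R bP.
  have [t1 [f1 o1]] := borel_finer_topology R bQ.
  exists t0, t1; split => //; apply: open_closedC; rewrite openE => z [j _ [Pz Qz]].
  exists (P j, Q j); last by move=> w [Pw Qw]; exists j.
  split; first exact: (open_nbhs_nbhs (conj (o0 j) Pz)).
  exact: (open_nbhs_nbhs (conj (o1 j) Qz)).
- by move=> z A0z [j _ [Pz Qz]]; exact: dis A0z Pz Qz.
- apply/seteqP; split => // z [nC /cov[j [Pz Qz]]]; apply: nC; by exists j.
Qed.

Lemma common_subgraph_separable (R : realType)
    (A0 A1 : set (prod_space (baire_space R) (baire_space R))) :
  analytic R A0 -> analytic R A1 -> A0 `&` A1 = set0 -> A1 `<=` baire_diagonal R ->
  {in A1 &, injective (fun z => evens z.1)} ->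
  {in A1 &, injective (fun z => odds z.1)} ->
  (forall z, A0 z -> exists n, evens z.2 = flips n (evens z.1)) ->
  (forall z, A0 z -> exists l, odds z.2 = fold l (odds z.1)) ->
  pot_closed_separable R A0 A1.
Proof.
move=> /analytic_baire_space[g0 [g1 [G [cg0 cg1 cG GA]]]].
move=> /analytic_baire_space[c [c' [Fc [cc _ cFc FA]]]].
move=> dis diag ie io ef eo.
have A1c v : Fc v -> A1 (c v, c v).
  move=> Fv; have Av : A1 (c v, c' v) by apply/FA; exists v.
  by have := Av; rewrite -(diag _ Av : c v = c' v).
have A0g w : G w -> A0 (g0 w, g1 w) by move=> Gw; apply/GA; exists w.
have [|v v'|v v'|w /A0g/ef//|w /A0g/eo//|P [Q [bP bQ cov PQ]]] :=
    @diagonal_covered c g0 g1 Fc G cc cg0 cg1 cFc cG.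
- move=> w v /A0g Aw /A1c Av w0 w1; suff : set0 (c v, c v) by [].
  by rewrite -dis; split => //; rewrite -{1}w0 -w1.
- move=> /A1c Av /A1c Av' e.
  by have [] := ie (c v, c v) (c v', c v') (mem_set Av) (mem_set Av') e.
- move=> /A1c Av /A1c Av' e.
  by have [] := io (c v, c v) (c v', c v') (mem_set Av) (mem_set Av') e.
apply: (borel_cover_separable bP bQ).
  move=> [x y] Axy; have /FA[v Fv [xv _]] := Axy.
  have [j [Pj Qj]] := cov v Fv; exists j.
  by rewrite /= -(diag _ Axy : x = y) xv.
by move=> j [x y] /GA[w Gw [-> ->]]; exact: PQ.
Qed.

Lemma analytic_image (R : realType) (X Y : topologicalType) (f : X -> Y) A :
  continuous f -> analytic R A -> analytic R (f @` A).
Proof.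
move=> cf [Z [g [pZ cg <-]]]; exists Z, (f \o g); split => //.
  by move=> z; apply: continuous_comp; [exact: cg|exact: cf].
by rewrite image_comp.
Qed.

Lemma continuous_join (R : realType) (Z : topologicalType) (f g : Z -> baire_space R) :
  continuous f -> continuous g ->
  continuous (fun z => join (f z) (g z) : baire_space R).
Proof.
move=> /continuous_agree cf /continuous_agree cg.
apply/continuous_agree => z n; apply: filterS (filterI (cf z n) (cg z n)).
move=> y [fy gy] i ni; rewrite /join.
by case: ifP => _; [rewrite gy//|rewrite fy//]; lia.
Qed.

Lemma continuous_prod_map (Z0 Z1 X0 X1 : topologicalType) (f0 : Z0 -> X0) (f1 : Z1 -> X1) :
  continuous f0 -> continuous f1 ->
  continuous (prod_map f0 f1 : prod_space Z0 Z1 -> prod_space X0 X1).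
Proof.
move=> c0 c1; apply: continuous_pair_space => z.
  by apply: continuous_comp; [exact: cvg_fst|exact: c0].
by apply: continuous_comp; [exact: cvg_snd|exact: c1].
Qed.

Theorem theorem7p1 (R : realType) :
  ~ exists (Z0 Z1 : topologicalType) (S0 S1 : set (prod_space Z0 Z1)),
      disjoint_analytic_pair R S0 S1 /\
      forall (X0 X1 : topologicalType) (B0 B1 : set (prod_space X0 X1)),
        disjoint_analytic_pair R B0 B1 ->
        exactly_one (pot_closed_separable R B0 B1)
                    (inj_reducible S0 S1 B0 B1).
Proof.
move=> [Z0 [Z1 [S0 [S1 [[_ _ aS0 aS1 _] minS]]]]].
have [f0 [f1 [cf0 cf1 fi fS0 fS1]]] :
    inj_reducible S0 S1 (functions_graph R flips) (baire_diagonal R).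
  have pr := @functions_graph_pair R flips (@twist_cont _ _) flips_neq.
  have [[sep _]|[_ //]] := minS _ _ _ _ pr; exfalso; move: sep.
  apply: functions_graph_nonseparable flips_comeager _.
  by move=> n; exists (bound id n) => x; exact: twist_agree.
have [g0 [g1 [cg0 cg1 gi gS0 gS1]]] :
    inj_reducible S0 S1 (functions_graph R fold) (baire_diagonal R).
  have pr := @functions_graph_pair R fold (@twist_cont _ _) fold_neq.
  have [[sep _]|[_ //]] := minS _ _ _ _ pr; exfalso; move: sep.
  apply: functions_graph_nonseparable fold_comeager _.
  by move=> n; exists (bound code_row n) => x; exact: twist_agree.
pose k0 z : baire_space R := join (f0 z) (g0 z).
pose k1 z : baire_space R := join (f1 z) (g1 z).
have ck0 : continuous k0 by exact: continuous_join.
have ck1 : continuous k1 by exact: continuous_join.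
pose k : prod_space Z0 Z1 -> prod_space (baire_space R) (baire_space R) :=
  prod_map k0 k1.
have ck : continuous k by exact: continuous_prod_map.
have aA0 := analytic_image ck aS0; have aA1 := analytic_image ck aS1.
have dis : k @` S0 `&` k @` S1 = set0.
  apply/seteqP; split => // _ [[s S0s <-] [s' S1s' [e0 e1]]].
  have [n sn] := fS0 _ S0s; have /= s'd := fS1 _ S1s'.
  apply: (@flips_neq n (f0 s.1)).
  rewrite -[LHS](sn : f1 s.2 = _) -(evens_join (f1 s.2) (g1 s.2)).
  rewrite -(evens_join (f0 s.1) (g0 s.1)) -/(k0 s.1) -/(k1 s.2) -e0 -e1.
  by rewrite /k0 /k1 !evens_join (s'd : f0 s'.1 = f1 s'.2).
have diag : k @` S1 `<=` baire_diagonal R.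
  move=> _ [s S1s <-]; rewrite /baire_diagonal /= /k0 /k1.
  by rewrite (fS1 _ S1s : f0 s.1 = f1 s.2) (gS1 _ S1s : g0 s.1 = g1 s.2).
have sep : pot_closed_separable R (k @` S0) (k @` S1).
  apply: common_subgraph_separable => //.
  - move=> _ _ /set_mem[s S1s <-] /set_mem[s' S1s' <-] /=.
    rewrite /k0 !evens_join => e; congr k; apply: fi; rewrite ?inE; try by right.
    by rewrite /prod_map -(fS1 _ S1s : f0 s.1 = f1 s.2)
      -(fS1 _ S1s' : f0 s'.1 = f1 s'.2) e.
  - move=> _ _ /set_mem[s S1s <-] /set_mem[s' S1s' <-] /=.
    rewrite /k0 !odds_join => e; congr k; apply: gi; rewrite ?inE; try by right.
    by rewrite /prod_map -(gS1 _ S1s : g0 s.1 = g1 s.2)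
      -(gS1 _ S1s' : g0 s'.1 = g1 s'.2) e.
  - by move=> _ [s /fS0[n sn] <-]; exists n; rewrite /= /k0 /k1 !evens_join.
  - by move=> _ [s /gS0[n sn] <-]; exists n; rewrite /= /k0 /k1 !odds_join.
have [|[_]|[]//] := minS _ _ (k @` S0) (k @` S1).
  by split => //; exact: polish_baire_space.
apply; exists k0, k1; split => //.
- move=> s s' Ss Ss' [e0 e1]; apply: fi => //.
  by rewrite /prod_map -(evens_join (f0 s.1) (g0 s.1)) -/(k0 s.1) e0
    -(evens_join (f1 s.2) (g1 s.2)) -/(k1 s.2) e1 /k0 /k1 !evens_join.
- by move=> s S0s; exists s.
- by move=> s S1s; exists s.
Qed.
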